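(* Fix an integer $k\ge 1$. For each integer $n\ge k+1$ let $W_{n,k}$ be the number of balls that do not end up in their assigned pit in the placement procedure with $n$ balls, $n$ pits and $k$ absent-minded balls described in the context. Then, as $n\to\infty$, the random variable $$ \frac{W_{n,k}-k\log n}{\sqrt{k\log n}} $$ converges in distribution to a standard normal random variable.
   Context: Placement procedure: there are $n$ balls numbered $1,\ldots,n$ and a box with $n$ pits numbered $1,\ldots,n$; each pit holds one ball, and the pit assigned to ball $i$ is pit $i$. The first $k$ (absent-minded) balls are placed completely at random in $k$ distinct pits, i.e. the vector of pit numbers taken by balls $1,\ldots,k$ is uniformly distributed over all $k$-tuples of distinct elements of $\{1,\ldots,n\}$. Then the balls $k+1,k+2,\ldots,n$ are placed one after another in this order: ball $i$ takes pit $i$ if that pit is empty; otherwise, conditionally on all previous placements, it takes a pit chosen uniformly at random among all currently empty pits. For $i\in\{1,\ldots,n\}$ let $A_i$ be the event that ball $i$ is placed in pit $i$, and let $W_{n,k}=\sum_{i=1}^n \mathbf{1}_{A_i^c}$, where $A_i^c$ is the complement of $A_i$. $\log$ is the natural logarithm. *)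

(* Defs.v *)
From HB Require Import structures.
From mathcomp Require Import all_boot all_order all_algebra.
From mathcomp Require Import all_classical all_reals all_analysis.

Set Implicit Arguments.
Unset Strict Implicit.
Unset Printing Implicit Defensive.

Import Order.TTheory GRing.Theory Num.Theory.
Import numFieldNormedType.Exports.

Local Open Scope classical_set_scope.
Local Open Scope ring_scope.

(* Balls and pits are numbered from 0 to n - 1, and
   the k absent-minded balls are those with i < k.  A placement is described by
   the random pits X i of the balls i; a possible outcome by s. *)

Definition empty_pits (n : nat) (s : {ffun 'I_n -> 'I_n}) (i : 'I_n) :
    {set 'I_n} :=
  ~: [set s l | l : 'I_n & (l < i)%N].

(* Conditional probability that ball i takes pit j, given that the balls l < i
   took the pits s l. *)
Definition next_pit_prob (R : realType) (n : nat) (s : {ffun 'I_n -> 'I_n})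
    (i j : 'I_n) : R :=
  if i \in empty_pits s i then (j == i)%:R
  else (j \in empty_pits s i)%:R / #|empty_pits s i|%:R.

Definition agree_below (T : Type) (n : nat) (X : 'I_n -> T -> 'I_n)
    (s : {ffun 'I_n -> 'I_n}) (m : nat) : set T :=
  [set t | forall l : 'I_n, (l < m)%N -> X l t = s l].

(* n ^_ k is the number of k-tuples of distinct pits.  The conditional law in
   the last clause is given in product form, which is void on null histories. *)
Record placement_procedure (R : realType) (d : measure_display)
    (T : measurableType d) (P : probability T R) (k n : nat)
    (X : 'I_n -> T -> 'I_n) : Prop := PlacementProcedure {
  measurable_pit : forall i j : 'I_n, measurable (X i @^-1` [set j]) ;
  absent_minded_law : forall s : {ffun 'I_n -> 'I_n},
    P (agree_below X s k) =
    ((dinjectiveb s [pred l : 'I_n | (l < k)%N])%:R / (n ^_ k)%:R)%:E ;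
  next_ball_law : forall (i : 'I_n), (k <= i)%N ->
    forall (s : {ffun 'I_n -> 'I_n}) (j : 'I_n),
    P (agree_below X s i `&` X i @^-1` [set j]) =
    (P (agree_below X s i) * (next_pit_prob R s i j)%:E)%E }.

Definition misplaced (T : Type) (n : nat) (X : 'I_n -> T -> 'I_n) (t : T) :
    nat :=
  (\sum_(i < n) (X i t != i))%N.

(* The Z n live on possibly different probability spaces, and need be random
   variables only from some n on. *)
Definition cvg_in_distribution (R : realType) (d : nat -> measure_display)
    (T : forall n, measurableType (d n)) (P : forall n, probability (T n) R)
    (Z : forall n, T n -> R) (mu : probability (measurableTypeR R) R) : Prop :=
  (\forall n \near \oo, measurable_fun setT (Z n)) /\
  (forall x : R, {for x, continuous (fun y : R => mu `]-oo, y]%classic)} ->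
    P n (Z n @^-1` `]-oo, x]%classic) @[n --> \oo] --> mu `]-oo, x]%classic).

(* Main.v *)
Require Import Defs.
From HB Require Import structures.
From mathcomp Require Import all_boot all_order all_algebra.
From mathcomp Require Import all_classical all_reals all_analysis.
From mathcomp Require Import ring lra.

Set Implicit Arguments.
Unset Strict Implicit.
Unset Printing Implicit Defensive.

Import Order.TTheory GRing.Theory Num.Theory.
Import numFieldNormedType.Exports.

Local Open Scope classical_set_scope.
Local Open Scope ring_scope.

(** Let k <= i and let the balls numbered below i be placed. The pits k, ..., i-1
are then occupied, since a ball l >= k that is not put into pit l has found it
full; so exactly k of the n - i + k pits in {0, ..., k-1} and {i, ..., n-1}
are occupied. This k-subset is uniformly distributed and independent of the
number of balls k, ..., i-1 that were misplaced. Indeed ball i finds its pit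
taken with probability k / (n - i + k); if so, one element of the subset, i,
is replaced by a uniformly chosen empty pit, and otherwise i is not in the
subset: either way a uniform k-subset remains, for which i is no longer
available ([pr_state]). So the number of misplaced balls, the first k left
aside, is a sum of independent Bernoulli variables with parameters k / j for
k<j<=n ([prob_late_misplaced]). Its mean and variance are k ln n + O(1), and
the first k balls add at most k to it, which is negligible compared with
sqrt(k ln n).

The central limit theorem for this sum is proved by Lindeberg's replacement
method, with the indicator of a half-line smoothed by a Gaussian beforehand.
The function Phi (y / sqrt v), where Phi is the standard normal distribution
function, solves the heat equation in (v, y); hence averaging it over a
centred Bernoulli step of variance p (1 - p) has the effect of increasing v by
p (1 - p), up to an error of order p (1 - p) v ^ (-3/2)
([Phi_bernoulli_step]). The indicator of y >= 0 lies between Phi ((y - b) / s)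
and Phi ((y + b) / s) up to the tails of Phi beyond b / s. Applying all the
steps to these two functions compares the distribution function of a sum of
mean m and variance v with Phi ((t - m -+ b) / sqrt (s ^ 2 + v)), up to the
tails and to 64 v / s ^ 3 ([bernoulli_sum_cdf_normal]). For k ln n = u ^ 16
the choice s = u ^ 6, b = u ^ 7 makes s and b negligible compared with sqrt v,
of order u ^ 8, and b / s = u and s ^ 3 / v, of order u ^ 2, large, so that
both bounds tend to Phi. *)

(** * The standard normal distribution function *)

Section normal.
Context {R : realType}.
Implicit Types x y z h : R.

Definition Phi x : R := fine (normal_prob 0 1 `]-oo, x]).
Definition phi x : R := normal_pdf 0 1 x.

Lemma PhiE x : normal_prob 0 1 `]-oo, x] = (Phi x)%:E.
Proof. by rewrite /Phi fineK// fin_num_measure. Qed.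

Lemma is_derive_Phi x : is_derive x 1 Phi (phi x).
Proof.
have mI (y : R) : lebesgue_measure.-integrable `]-oo, y] (EFin \o phi).
  by apply: integrableS (integrable_normal_pdf 0 1) => //; exact: subsetT.
have xx1 : x < x + 1 by rewrite ltrDl.
have [||d e] := continuous_FTC1 xx1 (mI _).
- by rewrite ltNyr.
- exact: continuous_normal_pdf.
by apply: DeriveDef; [exact: d|rewrite -derive1E; exact: e].
Qed.

Lemma phiE x : phi x = normal_peak 1 * expR (- x ^+ 2 / 2).
Proof. by rewrite /phi normal_pdfE// /normal_fun subr0 expr1n. Qed.

Lemma phi_ge0 x : 0 <= phi x. Proof. exact: normal_pdf_ge0. Qed.

Lemma is_derive_phi x : is_derive x 1 phi (- x * phi x).
Proof.
rewrite (_ : phi = fun x => normal_peak 1 * expR (- x ^+ 2 / 2)); last first.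
  by apply/funext => y; rewrite phiE.
apply: is_derive_eq; rewrite /GRing.scale/=.
by field.
Qed.

Lemma normal_peak1_le1 : normal_peak (1 : R) <= 1.
Proof.
rewrite /normal_peak expr1n mul1r invf_le1.
  by rewrite -sqrtr1 ler_wsqrtr// mulr2n; have := @pi_ge2 R; move: (pi : R) => p; lra.
by rewrite sqrtr_gt0 mulrn_wgt0// pi_gt0.
Qed.

(** Squaring 1 + x^2 / 4 <= exp (x^2 / 4) bounds the polynomial by
16 exp (x^2 / 2). *)
Lemma phi_poly_le x : (1 + x ^+ 2 + x ^+ 4) * phi x <= 16.
Proof.
have e0 := expR_gt0 (x ^+ 2 / 4).
have le1 : 1 + x ^+ 2 / 4 <= expR (x ^+ 2 / 4) := expR_ge1Dx _.
have le2 : 1 + x ^+ 2 + x ^+ 4 <= 16 * expR (x ^+ 2 / 2).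
  rewrite (_ : x ^+ 2 / 2 = x ^+ 2 / 4 + x ^+ 2 / 4); last by field.
  rewrite expRD; nra.
rewrite phiE mulrCA; apply: le_trans (_ : 1 * 16 <= _); last by rewrite mul1r.
apply: ler_pM; rewrite ?normal_peak_ge0 ?normal_peak1_le1//.
  by rewrite mulr_ge0 ?expR_ge0//; nra.
by rewrite mulNr expRN ler_pdivrMr ?expR_gt0.
Qed.

Lemma phi_monomial_le x : [/\ `|x * phi x| <= 16, `|x ^+ 2 * phi x - phi x| <= 16 &
  `|x ^+ 3 * phi x| <= 16].
Proof.
have := phi_poly_le x; have := phi_ge0 x; move: (phi x) => p p0 H.
have b (m : R) : `|m| <= 1 + x ^+ 2 + x ^+ 4 -> `|m * p| <= 16.
  by move=> mx; rewrite normrM (ger0_norm p0); apply: le_trans H; exact: ler_wpM2r.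
have x2 : 0 <= x ^+ 2 := sqr_ge0 x.
have x4 : 0 <= (x ^+ 2 - 1) ^+ 2 := sqr_ge0 _.
have x3 : 0 <= (x - 1) ^+ 2 := sqr_ge0 _.
have x3' : 0 <= (x + 1) ^+ 2 := sqr_ge0 _.
rewrite (_ : x ^+ 2 * p - p = (x ^+ 2 - 1) * p); last by ring.
by split; apply: b; rewrite ler_norml; apply/andP; split; nra.
Qed.

Lemma Phi_le1 x : Phi x <= 1.
Proof. by rewrite -lee_fin -PhiE probability_le1. Qed.

Lemma Phi_ge0 x : 0 <= Phi x.
Proof. by rewrite -lee_fin -PhiE. Qed.

Lemma Phi_nondecreasing : {homo Phi : x y / x <= y}.
Proof.
move=> x y xy; rewrite -lee_fin -!PhiE le_measure ?inE//.
by apply: subset_itvl; rewrite bnd_simp.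
Qed.

Let idR : measurableTypeR R -> R := idfun.

#[local] HB.instance Definition _ :=
  @isMeasurableFun.Build _ _ _ _ idR (@measurable_id _ _ setT).

Lemma cdf_normal_prob : cdf (idR : {RV normal_prob (0 : R) 1 >-> R}) = EFin \o Phi.
Proof. by apply/funext => r; rewrite /= -PhiE. Qed.

Lemma cvg_Phi_pinfty : Phi x @[x --> +oo] --> (1 : R).
Proof.
have := cvg_cdfy1 (idR : {RV normal_prob (0 : R) 1 >-> R}).
by rewrite cdf_normal_prob => /fine_cvgP[].
Qed.

Lemma cvg_Phi_ninfty : Phi x @[x --> -oo] --> (0 : R).
Proof.
have := cvg_cdfNy0 (idR : {RV normal_prob (0 : R) 1 >-> R}).
by rewrite cdf_normal_prob => /fine_cvgP[].
Qed.

Lemma MVT_derive (f df : R -> R) (a b : R) : a <= b ->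
  (forall y : R, is_derive y 1 f (df y)) ->
  exists2 c, a <= c <= b & f b - f a = df c * (b - a).
Proof.
move=> ab fd; have [|c cab ->] := MVT_segment ab (fun y _ => fd y).
  apply: continuous_subspaceT => y.
  exact/differentiable_continuous/derivable1_diffP.
by exists c => //; move: cab; rewrite in_itv.
Qed.

Lemma MVT_shift (f df : R -> R) x h : (forall y, is_derive y 1 f (df y)) ->
  exists2 c, `|c| <= `|h| & f (x + h) - f x = df (x + c) * h.
Proof.
move=> fd; have [h0|/ltW h0] := leP 0 h.
  have xh : x <= x + h by lra.
  have [c /andP[xc cx] ->] := MVT_derive xh fd; exists (c - x).
    by rewrite !ger0_norm//; lra.
  by congr (df _ * _); ring.
have xh : x + h <= x by lra.
have [c /andP[xc cx] e] := MVT_derive xh fd; exists (c - x).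
  by rewrite !ler0_norm//; lra.
by rewrite (addrC x (c - x)) subrK -[LHS]opprB e; ring.
Qed.

Lemma Taylor1_le (f f1 f2 : R -> R) (K : R) x h :
  (forall y, is_derive y 1 f (f1 y)) -> (forall y, is_derive y 1 f1 (f2 y)) ->
  (forall y, `|f2 y| <= K) -> `|f (x + h) - f x - h * f1 x| <= K * h ^+ 2.
Proof.
move=> d1 d2 f2K; have [c ch ->] := MVT_shift x h d1.
have [c' _ e] := MVT_shift x c d2.
have -> : f1 (x + c) * h - h * f1 x = f2 (x + c') * c * h by rewrite -e; ring.
rewrite -(real_normK (num_real h)) expr2 !normrM mulrA ler_wpM2r//.
exact: ler_pM.
Qed.

Lemma Taylor2_le (f f1 f2 f3 : R -> R) (K : R) x h :
  (forall y, is_derive y 1 f (f1 y)) -> (forall y, is_derive y 1 f1 (f2 y)) ->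
  (forall y, is_derive y 1 f2 (f3 y)) ->
  (forall y, `|f3 y| <= K) ->
  `|f (x + h) - f x - h * f1 x - h ^+ 2 / 2 * f2 x| <= K * `|h| ^+ 3.
Proof.
move=> d1 d2 d3 f3K.
pose g u := f (x + u) - u * f1 x - u ^+ 2 / 2 * f2 x.
have gd (u : R) : is_derive u 1 g (f1 (x + u) - f1 x - u * f2 x).
  have d1u : is_derive u 1 (fun u : R => f (x + u)) (f1 (x + u)).
    rewrite -[f1 _]mulr1; apply: (@is_derive1_comp _ f (cst x + id)).
    by apply: is_derive_eq; rewrite add0r.
  by apply: is_derive_eq; rewrite /GRing.scale/=; field.
have [c ch e] := MVT_shift 0 h gd.
rewrite (_ : _ - _ - _ = g (0 + h) - g 0); last first.
  by rewrite /g add0r addr0; field.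
rewrite e add0r normrM exprSr mulrA ler_wpM2r//.
apply: le_trans (Taylor1_le x c d2 d3 f3K) _.
rewrite -(real_normK (num_real c)) ler_wpM2l//.
  by apply: le_trans (f3K 0).
by rewrite lerXn2r ?nnegrE.
Qed.

(** The bound on the remainder is uniform in x because Phi''' = (x^2 - 1) phi is
bounded. *)
Lemma Taylor_Phi x h :
  `|Phi (x + h) - Phi x - h * phi x + h ^+ 2 / 2 * (x * phi x)| <= 16 * `|h| ^+ 3.
Proof.
have d3 (y : R) : is_derive y 1 (fun x => - x * phi x) (y ^+ 2 * phi y - phi y).
  have dp := is_derive_phi y.
  by apply: is_derive_eq; rewrite /GRing.scale/=; ring.
have bd (y : R) : `|y ^+ 2 * phi y - phi y| <= 16 by case: (phi_monomial_le y).
have := Taylor2_le x h is_derive_Phi is_derive_phi d3 bd.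
by rewrite mulNr mulrN opprK.
Qed.

(** First-order effect of adding variance s to a unit variance.  With
r = 1 / sqrt (1 + s), this is the second-order Taylor estimate in r of
Phi (z r) at r = 1, combined with 1 - r = s / 2 + O(s^2). *)
Lemma Phi_scale (z s : R) : 0 <= s <= 1 ->
  `|Phi (z / Num.sqrt (1 + s)) - Phi z + s / 2 * (z * phi z)| <= 48 * s ^+ 2.
Proof.
move=> /andP[s0 s1]; set r : R := (Num.sqrt (1 + s))^-1.
have r0 : 0 < r by rewrite invr_gt0 sqrtr_gt0; lra.
(* The estimates of 1 - r below are algebraic consequences of this equation. *)
have r2 : r ^+ 2 * (1 + s) = 1.
  by rewrite exprVn sqr_sqrtr ?mulVf//; lra.
have r1 : r <= 1 by nra.
have rs : (1 - r) <= s by nra.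
have rs2 : `|1 - r - s / 2| <= s ^+ 2.
  have r3 : r ^+ 3 * (1 + s) = r by rewrite exprS -mulrA r2 mulr1.
  have -> : 1 - r - s / 2 = - ((1 - r) ^+ 2 * ((1 + s) * (2 * r + 1) / 2)) by lra.
  have -> : s ^+ 2 = (1 - r) ^+ 2 * ((1 + s) * (1 + r)) ^+ 2.
    by rewrite -exprMn; congr (_ ^+ 2); lra.
  rewrite normrN ger0_norm; last by rewrite mulr_ge0 ?sqr_ge0//; nra.
  by rewrite ler_wpM2l ?sqr_ge0//; nra.
have dP (y : R) : is_derive y 1 (fun y => Phi (z * y)) (z * phi (z * y)).
  rewrite (mulrC z); apply: (@is_derive1_comp _ Phi (cst z * id)).
    exact: is_derive_Phi.
  by apply: is_derive_eq; rewrite /GRing.scale/=; ring.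
have dp (y : R) : is_derive y 1 (fun y => z * phi (z * y)) (- (z ^+ 3 * y * phi (z * y))).
  have d : is_derive y 1 (fun y => phi (z * y)) (- (z * y) * phi (z * y) * z).
    apply: (@is_derive1_comp _ phi (cst z * id)).
      exact: is_derive_phi.
    by apply: is_derive_eq; rewrite /GRing.scale/=; ring.
  by apply: is_derive_eq; rewrite /GRing.scale/=; ring.
have [c /andP[rc c1]] := MVT_derive r1 dP; rewrite mulr1 => e1.
have [c' /andP[cc' c'1]] := MVT_derive c1 dp; rewrite mulr1 => e2.
have [_ _ b3] := phi_monomial_le (z * c').
have [b1 _ _] := phi_monomial_le z.
have c'0 : 0 < c' by lra.
(* c' is at least r, and r ^+ 2 is at least 1 / 2 because s <= 1. *)
have c'2 : 1 <= 2 * c' ^+ 2 by nra.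
have B : `|z ^+ 3 * c' * phi (z * c')| <= 32.
  apply: le_trans (_ : 2 * c' ^+ 2 * `|z ^+ 3 * c' * phi (z * c')| <= _).
    by rewrite ler_peMl.
  rewrite -(@ger0_norm _ (2 * c' ^+ 2)) -?normrM; last by nra.
  have -> : 2 * c' ^+ 2 * (z ^+ 3 * c' * phi (z * c')) =
      2 * ((z * c') ^+ 3 * phi (z * c')) by ring.
  by rewrite normrM ger0_norm//; lra.
have e : z ^+ 3 * c' * phi (z * c') * (1 - c) = z * phi (z * c) - z * phi z.
  by rewrite -[RHS]opprB e2; ring.
have -> : Phi (z * r) - Phi z + s / 2 * (z * phi z) =
    - (z * phi z) * (1 - r - s / 2) -
    z ^+ 3 * c' * phi (z * c') * (1 - c) * (1 - r).
  by rewrite e -[Phi (z * r) - _]opprB e1; ring.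
apply: le_trans (ler_normB _ _) _.
rewrite (normrM _ (1 - r - s / 2)) normrN (normrM _ (1 - r)) (normrM _ (1 - c)).
rewrite (@ger0_norm _ (1 - c)) ?(@ger0_norm _ (1 - r)); [|lra..].
rewrite (_ : 48 = 16 + 32 :> R); last by ring.
rewrite mulrDl lerD//; first by apply: ler_pM.
by rewrite -mulrA; apply: ler_pM => //; rewrite ?mulr_ge0 ?expr2 ?ler_pM//; lra.
Qed.

(** Both sides have the same second-order expansion at z = y / s: the Bernoulli step is
centred, so that its first-order terms cancel, and its second-order term
p (1 - p) / (2 s^2) * Phi'' z, where Phi'' z = - z phi z, is the first-order effect of the
increase of the variance.  In the error, 16 comes from [Taylor_Phi] and 48 from
[Phi_scale]. *)
Lemma Phi_bernoulli_step (y s p : R) : 1 <= s -> 0 <= p <= 1 ->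
  `|(1 - p) * Phi ((y + p) / s) + p * Phi ((y - (1 - p)) / s) -
    Phi (y / Num.sqrt (s ^+ 2 + p * (1 - p)))| <= 64 * (p * (1 - p)) / s ^+ 3.
Proof.
move=> s1 /andP[p0 p1]; have s0 : 0 < s by lra.
pose q : R := 1 - p; have q0 : 0 <= q by rewrite /q; lra.
have q1 : q <= 1 by rewrite /q; lra.
pose w := p * q / s ^+ 2; pose z := y / s.
have pq0 : 0 <= p * q by rewrite mulr_ge0.
have pq1 : p * q <= 1 by rewrite mulr_ile1.
have i0 : 0 < s^-1 by rewrite invr_gt0.
have i1 : s^-1 <= 1 by rewrite invf_le1.
have w01 : 0 <= w <= 1.
  rewrite /w -exprVn mulr_ge0 ?exprn_ge0 ?(ltW i0)//=.
  by rewrite mulr_ile1 ?exprn_ge0 ?exprn_ile1 ?(ltW i0).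
have -> : y / Num.sqrt (s ^+ 2 + p * (1 - p)) = z / Num.sqrt (1 + w).
  have -> : s ^+ 2 + p * (1 - p) = s ^+ 2 * (1 + w).
    by rewrite /w /q; field; lra.
  by rewrite sqrtrM ?sqr_ge0// sqrtr_sqr gtr0_norm// invfM mulrA.
have -> : (y + p) / s = z + p / s by rewrite /z; field; lra.
have -> : (y - (1 - p)) / s = z + - (q / s) by rewrite /z /q; field; lra.
have := Taylor_Phi z (p / s); have := Taylor_Phi z (- (q / s)).
have := Phi_scale z w01.
have [ps qs] : 0 <= p / s /\ 0 <= q / s by rewrite !divr_ge0 ?(ltW s0).
rewrite normrN (ger0_norm ps) (ger0_norm qs).
set a := Phi (z / _); set b := Phi (z + - _); set c := Phi (z + _).
set f := Phi z; set g := z * phi z; move=> Ha Hb Hc.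
have -> : (1 - p) * c + p * b - a =
    q * (c - f - p / s * phi z + (p / s) ^+ 2 / 2 * g) +
    p * (b - f - - (q / s) * phi z + (- (q / s)) ^+ 2 / 2 * g) -
    (a - f + w / 2 * g).
  by rewrite /w /q; field; lra.
have le1 : q * (16 * (p / s) ^+ 3) + p * (16 * (q / s) ^+ 3) <=
    16 * (p * (1 - p)) / s ^+ 3.
  have -> : q * (16 * (p / s) ^+ 3) + p * (16 * (q / s) ^+ 3) =
      16 * (p * q) / s ^+ 3 * (p ^+ 2 + q ^+ 2) by field; lra.
  rewrite -/q ler_piMr//; first by rewrite divr_ge0 ?exprn_ge0 ?mulr_ge0 ?(ltW s0).
  by rewrite /q; nra.
have le2 : 48 * w ^+ 2 <= 48 * (p * (1 - p)) / s ^+ 3.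
  have -> : 48 * w ^+ 2 = 48 * (p * q) / s ^+ 3 * (p * q / s).
    by rewrite /w; field; lra.
  rewrite -/q ler_piMr//; first by rewrite divr_ge0 ?exprn_ge0 ?mulr_ge0 ?(ltW s0).
  by rewrite mulr_ile1 ?(ltW i0).
apply: le_trans (ler_normB _ _) _.
apply: le_trans (lerD (ler_normD _ _) (lexx _)) _.
rewrite (normrM q) (normrM p) (ger0_norm q0) (ger0_norm p0).
apply: le_trans (lerD (lerD (ler_wpM2l q0 Hc) (ler_wpM2l p0 Hb)) Ha) _.
have -> : 64 * (p * (1 - p)) / s ^+ 3 =
  16 * (p * (1 - p)) / s ^+ 3 + 48 * (p * (1 - p)) / s ^+ 3 by field; lra.
exact: lerD.
Qed.

End normal.

(** * Sums of independent Bernoulli variables *)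

Section bernoulli_sum.
Context {R : realType}.

(** The distribution function of a sum of N independent Bernoulli variables with
parameters p 0, ..., p (N - 1), by conditioning on the last variable. *)
Fixpoint bernoulli_sum_cdf (p : nat -> R) (N : nat) (t : R) : R :=
  if N is M.+1 then
    (1 - p M) * bernoulli_sum_cdf p M t + p M * bernoulli_sum_cdf p M (t - 1)
  else ((0 <= t)%R)%:R.

(** Induction on N: one more variable acts on the bounding normal distribution
functions by [Phi_bernoulli_step], whose error at variance s^2 + v is at most its
value at variance s^2, hence the errors add up to 64 v / s^3.  For N = 0 the bounds are
those of the indicator of t >= 0 by shifted normal distribution functions. *)
Lemma bernoulli_sum_cdf_normal (p : nat -> R) (N : nat) (s b : R) :
  (forall i, (i < N)%N -> 0 <= p i <= 1) -> 1 <= s -> 0 <= b ->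
  let m := \sum_(i < N) p i in
  let v := \sum_(i < N) p i * (1 - p i) in
  forall t,
  Phi ((t - m - b) / Num.sqrt (s ^+ 2 + v)) - (Phi (- b / s) + 64 * v / s ^+ 3)
    <= bernoulli_sum_cdf p N t <=
  Phi ((t - m + b) / Num.sqrt (s ^+ 2 + v)) +
    (1 - Phi (b / s) + 64 * v / s ^+ 3).
Proof.
move=> p01 s1 b0 m v; rewrite {}/m {}/v; have s0 : 0 < s by lra.
have lower (q A B C D e' Z e x y : R) :
    q * (B - (Z + e)) <= q * y -> (1 - q) * (A - (Z + e)) <= (1 - q) * x ->
    D <= e' -> - D <= (1 - q) * A + q * B - C ->
    C - (Z + (e + e')) <= (1 - q) * x + q * y by lra.
have upper (q A B C D e' Z e x y : R) :
    q * y <= q * (B + (Z + e)) -> (1 - q) * x <= (1 - q) * (A + (Z + e)) ->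
    D <= e' -> (1 - q) * A + q * B - C <= D ->
    (1 - q) * x + q * y <= C + (Z + (e + e')) by lra.
elim: N p01 => [_|N IH p01] t.
  rewrite !big_ord0 subr0 addr0 mulr0 mul0r !addr0 sqrtr_sqr gtr0_norm//=.
  have [t0|t0] := leP 0 t.
    have := Phi_le1 ((t - b) / s); have := Phi_ge0 (- b / s).
    have : Phi (b / s) <= Phi ((t + b) / s).
      by apply: Phi_nondecreasing; rewrite ler_pM2r ?invr_gt0//; lra.
    by rewrite /= mulr1n => *; apply/andP; split; lra.
  have := Phi_le1 (b / s); have := Phi_ge0 ((t + b) / s).
  have : Phi ((t - b) / s) <= Phi (- b / s).
    by apply: Phi_nondecreasing; rewrite ler_pM2r ?invr_gt0//; lra.
  by rewrite /= mulr0n => *; apply/andP; split; lra.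
rewrite !big_ord_recr/=; have pN := p01 N (ltnSn N).
have {}IH := IH (fun i iN => p01 i (ltnW iN)).
move: (p N) pN => q /[dup] /andP[q0 q1] q01.
set m := \sum_(i < N) p i in IH *.
set v := \sum_(i < N) p i * (1 - p i) in IH *.
have v0 : 0 <= v.
  apply: sumr_ge0 => i _; have /andP[pi0 pi1] := p01 i (ltnW (ltn_ord i)).
  by rewrite mulr_ge0// subr_ge0.
have S2 : Num.sqrt (s ^+ 2 + v) ^+ 2 = s ^+ 2 + v.
  by rewrite sqr_sqrtr// addr_ge0 ?sqr_ge0.
have sS : s <= Num.sqrt (s ^+ 2 + v).
  by rewrite -{1}(gtr0_norm s0) -sqrtr_sqr ler_wsqrtr// lerDl.
have -> : s ^+ 2 + (v + q * (1 - q)) = Num.sqrt (s ^+ 2 + v) ^+ 2 + q * (1 - q).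
  by rewrite S2 addrA.
set S := Num.sqrt (s ^+ 2 + v) in IH S2 sS *.
have S1 : 1 <= S by lra.
have E0 : 64 * (q * (1 - q)) / S ^+ 3 <= 64 * (q * (1 - q)) / s ^+ 3.
  rewrite ler_wpM2l//; first by rewrite !mulr_ge0//; lra.
  by rewrite lef_pV2 ?posrE ?exprn_gt0 ?lerXn2r ?nnegrE//; lra.
have -> : 64 * (v + q * (1 - q)) / s ^+ 3 =
    64 * v / s ^+ 3 + 64 * (q * (1 - q)) / s ^+ 3 by field; lra.
have /andP[H1 H2] := IH t; have /andP[H3 H4] := IH (t - 1).
have q'0 : 0 <= 1 - q by lra.
apply/andP; split.
  have := Phi_bernoulli_step (t - (m + q) - b) S1 q01.
  rewrite ler_norml => /andP[+ _]; move: E0.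
  have := ler_wpM2l q'0 H1; have := ler_wpM2l q0 H3.
  have -> : t - 1 - m - b = t - (m + q) - b - (1 - q) by ring.
  have -> : t - m - b = t - (m + q) - b + q by ring.
  exact: lower.
have := Phi_bernoulli_step (t - (m + q) + b) S1 q01.
rewrite ler_norml => /andP[_]; move: E0.
have := ler_wpM2l q'0 H2; have := ler_wpM2l q0 H4.
have -> : t - 1 - m + b = t - (m + q) + b - (1 - q) by ring.
have -> : t - m + b = t - (m + q) + b + q by ring.
exact: upper.
Qed.
End bernoulli_sum.

(** * The law of the placement procedure on finite histories *)

Section finite_law.
Context {R : realType} (n : nat).
Local Notation hist := {ffun 'I_n -> 'I_n}.
Implicit Types (s : hist) (m : nat) (D : {set 'I_n}) (A B : pred hist).

Definition agree s m : pred hist :=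
  [pred s' : hist | [forall l : 'I_n, (l < m)%N ==> (s' l == s l)]].

Lemma agreeP s m s' : reflect (forall l : 'I_n, (l < m)%N -> s' l = s l) (agree s m s').
Proof. by apply: (iffP forall_inP) => H l /H /eqP. Qed.

Definition occupied s m : {set 'I_n} := [set s l | l : 'I_n & (l < m)%N].

Definition late_misplaced k s m : nat := (\sum_(i < n | (k <= i < m)%N) (s i != i))%N.

Lemma eq_occupied s s' m : agree s m s' -> occupied s' m = occupied s m.
Proof. by move=> /agreeP a; apply: eq_in_imset => l; rewrite !inE => /a. Qed.

Lemma eq_late_misplaced k s s' m : agree s m s' ->
  late_misplaced k s' m = late_misplaced k s m.
Proof. by move=> /agreeP a; apply: eq_bigr => l /andP[_ /a ->]. Qed.

(** A representative of the histories that begin with f. *)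
Definition extend m (f : {ffun 'I_m -> 'I_n}) : hist :=
  [ffun l : 'I_n => if insub (l : nat) is Some l' then f l' else l].

Variable mu : hist -> R.
Definition pr A : R := \sum_(s | A s) mu s.

(** Here f ranges over the pits of the first m balls, which decide A. *)
Lemma pr_split m A B : (m <= n)%N ->
  (forall s s', agree s m s' -> A s' = A s) ->
  pr (predI A B) =
  \sum_(f : {ffun 'I_m -> 'I_n} | A (extend f)) pr (predI (agree (extend f) m) B).
Proof.
move=> mn Am; pose r s := [ffun l : 'I_m => s (widen_ord mn l)].
have rE s f : (r s == f) = agree (extend f) m s.
  apply/eqP/agreeP => [<- l lm|a].
    by rewrite ffunE insubT ffunE; congr (s _); apply/val_inj.
  apply/ffunP => l; rewrite ffunE a //= ffunE.
  by case: insubP => [l' _ ll'|]; [congr (f _); exact: val_inj|rewrite /= ltn_ord].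
rewrite /pr (partition_big r (fun f => A (extend f)))/=; last first.
  move=> s /andP[As _]; rewrite (Am s)//.
  have : agree (extend (r s)) m s by rewrite -rE.
  by move/agreeP => a; apply/agreeP => l lm; rewrite a.
apply: eq_bigr => f Af; apply: eq_bigl => s; rewrite rE /=.
rewrite andbC; case: (boolP (agree _ _ _)) => //= a.
by rewrite (Am _ _ a) Af.
Qed.

Variable k : nat.
Hypothesis kn : (k < n)%N.
Hypothesis law_absent : forall s,
  pr (agree s k) =
  (dinjectiveb s [pred l : 'I_n | (l < k)%N])%:R / (n ^_ k)%:R.
Hypothesis law_next : forall i : 'I_n, (k <= i)%N -> forall s j,
  pr (predI (agree s i) [pred s' : hist | s' i == j]) =
  pr (agree s i) * next_pit_prob R s i j.

(** The Markov property: the hypothesis on the next ball, given for complete past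
histories, passes to events that determine its transition probability. *)
Lemma pr_next A (i j : 'I_n) c : (k <= i)%N ->
  (forall s s', agree s i s' -> A s' = A s) ->
  (forall s, A s -> next_pit_prob R s i j = c) ->
  pr (predI A [pred s : hist | s i == j]) = pr A * c.
Proof.
move=> ki Ai Ac; have in_ : (i <= n)%N by rewrite ltnW.
have -> : pr A = pr (predI A predT) by apply: eq_bigl => s /=; rewrite andbT.
rewrite !(pr_split _ in_ Ai) mulr_suml; apply: eq_bigr => f Af.
rewrite law_next// Ac//; congr (_ * _).
by apply: eq_bigl => s /=; rewrite andbT.
Qed.

(** The absent-minded balls occupy a uniform k-subset: each D of cardinal k is the
image of k! of the n ^_ k equally likely injections. *)
Lemma pr_first_occupied D :
  pr [pred s : hist | occupied s k == D] = (#|D| == k)%:R / 'C(n, k)%:R.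
Proof.
have kn' := ltnW kn.
pose A := [pred s : hist | occupied s k == D].
have Ak s s' : agree s k s' -> A s' = A s by move=> /eq_occupied /= ->.
have -> : pr A = pr (predI A predT) by apply: eq_bigl => s /=; rewrite andbT.
rewrite (pr_split _ kn' Ak).
have extE f (l : 'I_k) : extend f (widen_ord kn' l) = f l.
  rewrite ffunE; case: insubP => [l' _ ll'|]; last by rewrite /= ltn_ord.
  by congr (f _); exact: val_inj.
have occE (f : {ffun 'I_k -> 'I_n}) : occupied (extend f) k = f @: 'I_k.
  apply/setP => j; apply/imsetP/imsetP => -[l].
    rewrite inE => lk ->; exists (Ordinal lk); rewrite ?inE//.
    by rewrite -extE; congr (extend f _); exact: val_inj.
  by move=> _ ->; exists (widen_ord kn' l); rewrite ?inE ?extE//=.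
have injE (f : {ffun 'I_k -> 'I_n}) :
    dinjectiveb (extend f) [pred l : 'I_n | (l < k)%N] = injectiveb f.
  apply/dinjectiveP/injectiveP => I l l'.
    move=> e; have := I (widen_ord kn' l) (widen_ord kn' l').
    rewrite !inE !extE => /(_ (ltn_ord l) (ltn_ord l') e).
    by move=> /(congr1 val)/= /val_inj.
  rewrite !inE => lk l'k.
  have -> : l = widen_ord kn' (Ordinal lk) by exact: val_inj.
  have -> : l' = widen_ord kn' (Ordinal l'k) by exact: val_inj.
  by rewrite !extE => /I ->.
under eq_bigr => f _.
  rewrite (_ : pr _ = pr (agree (extend f) k)); last first.
    by apply: eq_bigl => s /=; rewrite andbT.
  rewrite law_absent injE; over.
rewrite -mulr_suml -natr_sum.
have -> : (\sum_(f : {ffun 'I_k -> 'I_n} | A (extend f)) injectiveb f)%N =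
    ((#|D| == k) * k`!)%N.
  rewrite -big_mkcondr/= sum1_card.
  case: eqP => Dk; last first.
    rewrite mul0n; apply: eq_card0 => f; rewrite unfold_in/= occE.
    apply/negP => /andP[/eqP fD /injectiveP fI]; apply: Dk.
    by rewrite -fD card_imset// card_ord.
  have := card_inj_ffuns_on 'I_k (mem D).
  rewrite mul1n card_ord [#|mem D|]Dk ffactnn => <-.
  apply: eq_card => f; rewrite [LHS]unfold_in [RHS]inE/= occE andbC; apply/andP/andP => -[].
    move=> fI /eqP fD; split => //; apply/ffun_onP => l.
    by rewrite -fD imset_f// inE.
  move=> /ffun_onP fD /injectiveP fI; split; first exact/injectiveP.
  rewrite eqEcard card_imset// card_ord Dk leqnn andbT.
  by apply/fintype.subsetP => _ /imsetP[l _ ->].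
rewrite -bin_ffact !natrM -mulrA; congr (_ * _).
by rewrite invfM mulrCA mulfV ?mulr1// pnatr_eq0 -lt0n fact_gt0.
Qed.

(** The sets of pits that can be occupied once m >= k balls are placed. *)
Definition reachable m D : bool :=
  (#|D| == m) && [forall l : 'I_n, (k <= l < m)%N ==> (l \in D)].

(** The transition probability, as a function of the set D of occupied pits alone. *)
Definition pit_prob D (i j : 'I_n) : R :=
  if i \in D then (j \notin D)%:R / (n - #|D|)%:R else (j == i)%:R.

Lemma next_pit_prob_occupied s (i j : 'I_n) :
  next_pit_prob R s i j = pit_prob (occupied s i) i j.
Proof.
rewrite /next_pit_prob /pit_prob /empty_pits -/(occupied s i) !finset.in_setC.
by case: (i \in _) => //=; rewrite cardsCs finset.setCK card_ord.
Qed.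

Lemma occupied_succ s (i : 'I_n) : occupied s i.+1 = s i |: occupied s i.
Proof.
apply/setP => j; rewrite in_setU1; apply/imsetP/predU1P.
  move=> [l]; rewrite inE ltnS leq_eqVlt => /orP[/eqP/val_inj ->|li] ->.
    by left.
  by right; rewrite imset_f ?inE.
move=> [->|/imsetP[l]]; first by exists i; rewrite ?inE.
by rewrite inE => li ->; exists l; rewrite ?inE// ltnW.
Qed.

Lemma late_misplaced_succ s (i : 'I_n) : (k <= i)%N ->
  late_misplaced k s i.+1 = (late_misplaced k s i + (s i != i))%N.
Proof.
move=> ki; rewrite /late_misplaced (bigD1 i)/=; last by rewrite ki/= ltnS.
rewrite addnC; congr (_ + _)%N; apply: eq_bigl => l.
by rewrite ltnS ltn_neqAle -(inj_eq val_inj) -andbA; congr (_ && _); exact: andbC.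
Qed.

Definition state m (t : R) D : pred hist :=
  [pred s : hist | ((late_misplaced k s m)%:R <= t) && (occupied s m == D)].

(** Condition on the pit j of ball i: it is the element of D that was not occupied
before. *)
Lemma pr_state_succ (i : 'I_n) (t : R) D : (k <= i)%N ->
  pr (state i.+1 t D) =
  \sum_(j in D) pr (state i (t - (j != i)%:R) (D :\ j)) * pit_prob (D :\ j) i j.
Proof.
move=> ki; rewrite {1}/pr (partition_big (fun s : hist => s i) predT)//=.
rewrite [RHS]big_mkcond; apply: eq_bigr => j _ /=.
have stE s : state i.+1 t D s && (s i == j) =
    [&& (late_misplaced k s i)%:R <= t - (j != i)%:R, j |: occupied s i == D & s i == j].
  rewrite /state/= occupied_succ late_misplaced_succ//.
  by case: (eqVneq (s i) j) => [->|]; rewrite ?andbF ?andbT// natrD lerBrDr.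
under eq_bigl do rewrite stE.
have stA t' D' s s' : agree s i s' -> state i t' D' s' = state i t' D' s.
  by move=> a; rewrite /state/= (eq_occupied a) (eq_late_misplaced _ a).
have stp t' D' s : state i t' D' s -> next_pit_prob R s i j = pit_prob D' i j.
  by rewrite next_pit_prob_occupied => /andP[_ /eqP ->].
case: ifP => jD; last first.
  apply: big_pred0 => s; apply/negP => /and3P[_ /eqP oD _].
  by rewrite -oD setU11 in jD.
have disj : D :\ j != D.
  by apply/eqP => e; have := setD11 j D; rewrite e jD.
rewrite (bigID (fun s => occupied s i == D :\ j))/=.
rewrite -[RHS]addr0; congr (_ + _).
  rewrite -[pr _ * _](pr_next ki (stA _ _) (stp _ _)); apply: eq_bigl => s.
  rewrite /state/=; case: (eqVneq (occupied s i) (D :\ j)) => [->|_]; rewrite ?andbF// !andbT.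
  by rewrite finset.setD1K// eqxx.
(* The remaining case, in which j was already occupied, has probability 0. *)
transitivity (pr (predI (state i (t - (j != i)%:R) D) [pred s : hist | s i == j])).
  apply: eq_bigl => s; rewrite /state/=; case: (eqVneq (occupied s i) D) => [->|oD].
    by rewrite (finset.setUidPr _) ?finset.sub1set// eqxx (eq_sym D) disj !andbT.
  rewrite andbF/=; apply/negP => /andP[/and3P[_ /eqP o _] /negP]; apply.
  apply/eqP/setP => l; rewrite -o in_setD1 in_setU1.
  case: eqP => //= ->; apply/negP => js.
  by case/eqP: oD; rewrite -o; apply/esym/finset.setUidPr; rewrite finset.sub1set.
rewrite (pr_next ki (stA _ _) (stp _ _)) /pit_prob jD mul0r.
case: ifP => [_|iD]; first by rewrite mulr0.
case: eqP => [ji|]; last by rewrite mulr0.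
by rewrite -ji jD in iD.
Qed.

(** The probability that ball k + a finds its pit taken: k of the n - a pits
0, ..., k - 1 and k + a, ..., n - 1 are. *)
Definition misplacement_odds (a : nat) : R := k%:R / (n - a)%:R.

(** The right-hand side is a product: the number of misplaced balls is independent
of the set of occupied pits, and the latter is uniform on the reachable sets, of
which there are 'C(n - a, k). *)
Lemma pr_state (a : nat) (t : R) D : (k + a <= n)%N ->
  pr (state (k + a) t D) =
  (reachable (k + a) D)%:R *
  (bernoulli_sum_cdf misplacement_odds a t / 'C(n - a, k)%:R).
Proof.
elim: a t D => [|a IH] t D kan.
  rewrite addn0 subn0 /= /reachable mulrCA; case: (leP 0 t) => t0.
    rewrite mul1r (_ : [forall _, _] = true) ?andbT -?pr_first_occupied; last first.
      by apply/forall_inP => l; rewrite ltnNge andbN.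
    apply: eq_bigl => s; rewrite /state/= (_ : late_misplaced k s k = 0%N) ?t0//.
    by apply: big_pred0 => l; rewrite ltnNge andbN.
  rewrite mul0r; apply: big_pred0 => s; rewrite /state/=.
  by rewrite leNgt (lt_le_trans t0).
have kan' : (k + a < n)%N by rewrite -addnS.
pose i := Ordinal kan'; have ki : (k <= i)%N by rewrite leq_addr.
rewrite addnS -[(k + a)%N]/(i : nat) pr_state_succ//.
rewrite /= -/(i : nat).
have {}IH t' D' := IH t' D' (ltnW kan').
have [iD|iD] := boolP (i \in D); last first.
  rewrite (_ : reachable _ _ = false) ?mul0r; last first.
    apply/negP => /andP[_ /forall_inP/(_ i)].
    by rewrite ki ltnS leqnn (negbTE iD) => /(_ isT).
  apply: big1 => j jD; rewrite /pit_prob in_setD1 (negbTE iD) andbF.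
  case: eqP => [ji|]; last by rewrite mulr0.
  by rewrite -ji jD in iD.
have Di j : j \in D -> #|D :\ j| = #|D|.-1.
  by move=> jD; rewrite (cardsD1 j D) jD.
have D0 : (0 < #|D|)%N by rewrite (cardD1 i) iD.
(* A reachable set D contains i; the sets D minus j from which it can arise are
   those where j is i or one of the k elements of D outside [k, i]. *)
have reachE j : j \in D -> reachable (k + a) (D :\ j) =
    reachable i.+1 D && ((j == i) || ~~ (k <= j < i)%N).
  move=> jD; rewrite /reachable Di// -(eqn_add2r 1) !addn1 prednK//.
  rewrite -andbA; congr (_ && _); apply/forall_inP/andP.
    move=> H; split.
      apply/forall_inP => l; rewrite ltnS => /andP[kl].
      rewrite leq_eqVlt => /orP[/eqP/val_inj -> //|li].
      by have := H l; rewrite kl li => /(_ isT); rewrite in_setD1 => /andP[].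
    apply/orP; right; apply/negP => /(H j); rewrite setD11//.
  move=> [/forall_inP H J] l /andP[kl li].
  rewrite in_setD1 H ?kl ?ltnS 1?ltnW// andbT.
  apply/eqP => lj; move: J; rewrite -lj kl li/= orbF => /eqP e.
  by rewrite e ltnn in li.
have [rD|rD] := boolP (reachable i.+1 D); last first.
  rewrite mul0r; apply: big1 => j jD.
  by rewrite IH reachE// (negbTE rD) !mul0r.
have cD : #|D| = i.+1 by move: rD => /andP[/eqP].
rewrite mul1r (bigD1 i)//= eqxx subr0 IH reachE// rD eqxx mul1r.
rewrite {1}/pit_prob setD11 eqxx mulr1.
set x := bernoulli_sum_cdf _ a t; set y := bernoulli_sum_cdf _ a (t - 1).
set c := 'C(n - a, k)%:R.
rewrite (eq_bigr (fun j : 'I_n => (~~ (k <= j < i)%N)%:R * (y / c / (n - i)%:R))); last first.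
  move=> j /andP[jD ji]; rewrite IH reachE// rD (negbTE ji)/=.
  rewrite /pit_prob in_setD1 eq_sym ji iD setD11/= mul1r Di// cD/=.
  by rewrite -/y !mulrA.
rewrite -mulr_suml -natr_sum -big_mkcondr/= sum1_card.
pose E := [set j : 'I_n | (k <= j < i.+1)%N]%SET.
have ED : E \subset D.
  apply/fintype.subsetP => j; rewrite inE => jE.
  by move: rD => /andP[_ /forall_inP]; apply.
have cE : #|E| = (i.+1 - k)%N.
  have -> : E = [set j : 'I_n | (j < i.+1)%N]%SET :\: [set j : 'I_n | (j < k)%N]%SET.
    by apply/setP => j; rewrite !inE -leqNgt.
  have cI m : (m <= n)%N -> #|[set j : 'I_n | (j < m)%N]%SET| = m.
    move=> mn; have wI : injective (widen_ord mn) by move=> u v /(congr1 val)/= /val_inj.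
    rewrite -[RHS]card_ord -(card_imset _ wI).
    apply: eq_card => j; rewrite inE; apply/idP/imsetP => [jm|[l _ ->]]//=.
    by exists (Ordinal jm) => //; exact: val_inj.
  rewrite cardsD (finset.setIidPr _) ?cI// ?(ltnW kn)//.
  by apply/fintype.subsetP => j; rewrite !inE => /ltn_trans; apply; rewrite ltnS.
rewrite (_ : #|_| = k); last first.
  transitivity #|D :\: E|.
    apply: eq_card => j; rewrite [LHS]unfold_in !inE ltnS.
    have [->|ji] := eqVneq j i; first by rewrite leqnn ki andbF.
    by rewrite (leq_eqVlt j i) -[(_ == _ :> nat)]/(val j == val i)
      val_eqE (negbTE ji) andbT andbC.
  by rewrite cardsD (finset.setIidPr ED) cE cD subKn// ltnW.
have N0 : (0 < n - a)%N by rewrite subn_gt0 (leq_trans _ kan)// addnS ltnS leq_addl.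
(* Passing from n - a to n - a - 1 available pits changes the number of k-subsets by
   the factor 1 - k / (n - a), the probability that ball i finds its pit empty. *)
have bin : 'C(n - a, k)%:R * (n - i)%:R = (n - a)%:R * 'C(n - a.+1, k)%:R :> R.
  rewrite -!natrM; congr _%:R.
  by rewrite mulnC subnS mul_bin_down /= subnDA subnAC.
have b0 : 'C(n - a.+1, k)%:R != 0 :> R.
  by rewrite pnatr_eq0 -lt0n bin_gt0 leq_subRL ?(leq_trans _ kan)// ?leq_addl// addnC.
have m0 : (n - i)%:R != 0 :> R by rewrite pnatr_eq0 -lt0n subn_gt0.
have a0 : (n - a)%:R != 0 :> R by rewrite pnatr_eq0 -lt0n.
have an : (a <= n)%N := leq_trans (leq_addl k a) (ltnW kan').
have kE : k%:R = (n - a)%:R - (n - i)%:R :> R.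
  rewrite -natrB; last by rewrite /= leq_sub2l ?leq_addl.
  by rewrite /= addnC subnDA subKn// leq_subRL// addnC ltnW.
have -> : c = (n - a)%:R * 'C(n - a.+1, k)%:R / (n - i)%:R by rewrite -bin mulfK.
rewrite /misplacement_odds kE -[(k + a)%N]/(i : nat).
move: a0 b0 m0.
move: (n - a)%:R (n - i)%:R 'C(_, _)%:R => u v w u0 w0 v0.
by field; rewrite u0 v0 w0.
Qed.

(** When all balls are placed, the only reachable set is that of all pits. *)
Lemma pr_late_misplaced (t : R) :
  pr [pred s : hist | (late_misplaced k s n)%:R <= t] =
  bernoulli_sum_cdf misplacement_odds (n - k) t.
Proof.
rewrite /pr (partition_big (fun s => occupied s n) predT)//=.
rewrite (eq_bigr (fun D => (D == finset.setT)%:R *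
  bernoulli_sum_cdf misplacement_odds (n - k) t)).
  rewrite (bigD1 finset.setT)//= eqxx mul1r big1 ?addr0// => D /negbTE ->.
  by rewrite mul0r.
move=> D _; have kn' := ltnW kn.
transitivity (pr (state n t D)) => //.
have := @pr_state (n - k) t D; rewrite subnKC// => /(_ (leqnn _)) /= ->.
rewrite subKn// binn divr1; congr ((nat_of_bool _)%:R * _).
rewrite /reachable; apply/idP/idP => [/andP[/eqP Dn _]|/eqP ->].
  by rewrite eqEcard finset.subsetT cardsT card_ord Dn/=.
rewrite cardsT card_ord eqxx; apply/forall_inP => l _; exact: finset.in_setT.
Qed.
End finite_law.

(** * The number of misplaced balls *)

Section placement_law.
Context {R : realType} {d : measure_display} {T : measurableType d}.
Context (P : probability T R) (k n : nat) (X : 'I_n -> T -> 'I_n).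
Hypothesis kn : (k < n)%N.
Hypothesis XP : placement_procedure P k X.
Local Notation hist := {ffun 'I_n -> 'I_n}.

Definition history (t : T) : hist := [ffun l => X l t].

Lemma measurable_history (A : pred hist) : measurable [set t | A (history t)].
Proof.
have -> : [set t | A (history t)] =
    \bigcup_(s in [set` A]) \bigcap_(l in [set: 'I_n]) (X l @^-1` [set s l]).
  apply/seteqP; split => [t At|t [s /= As Xs]].
    by exists (history t) => // l _; rewrite /= ffunE.
  rewrite /= (_ : history t = s)//; apply/ffunP => l.
  by rewrite ffunE; exact: Xs.
apply: fin_bigcup_measurable => [|s _]; first exact: finite_finpred.
apply: fin_bigcap_measurable => [|l _]; first exact: finite_finset.
exact: (measurable_pit XP).
Qed.

Definition history_pmf (s : hist) : R := fine (P [set t | history t == s]).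

Lemma prob_history (A : pred hist) :
  P [set t | A (history t)] = (pr history_pmf A)%:E.
Proof.
have -> : [set t | A (history t)] = \bigcup_(s in [set` A]) [set t | history t == s].
  apply/seteqP; split => [t At|t [s /= As /eqP ->]//].
  by exists (history t) => /=.
rewrite measure_fin_bigcup; last 3 first.
- exact: finite_finpred.
- by move=> s s' _ _ [t [/= /eqP <- /eqP <-]].
- move=> s _; exact: (measurable_history (pred1 s)).
rewrite -(@bigfs _ _ _ _ (index_enum hist))//; last 2 first.
- exact: index_enum_uniq.
- by move=> s _; rewrite mem_index_enum.
rewrite /pr -sumEFin; apply: eq_bigr => s _.
by rewrite /history_pmf fineK// fin_num_measure//; exact: (measurable_history (pred1 s)).
Qed.

Lemma agree_belowE (s : hist) (m : nat) :
  agree_below X s m = [set t | agree s m (history t)].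
Proof.
apply/seteqP; split => t /=; first by move=> a; apply/agreeP => l /a; rewrite ffunE.
by move=> /agreeP a l /a; rewrite ffunE.
Qed.

Lemma prob_late_misplaced (x : R) :
  P [set t | (late_misplaced k (history t) n)%:R <= x] =
  (bernoulli_sum_cdf (misplacement_odds n k) (n - k) x)%:E.
Proof.
rewrite (prob_history [pred s : hist | (late_misplaced k s n)%:R <= x]).
congr _%:E; apply: pr_late_misplaced => // [s|i ki s j]; apply: EFin_inj.
  by rewrite -prob_history -agree_belowE (absent_minded_law XP).
rewrite EFinM -!prob_history -!agree_belowE -(next_ball_law XP)// agree_belowE.
by congr (P _); apply/seteqP; split => t /=; rewrite ffunE;
  [move=> /andP[? /eqP]|move=> [? /eqP ?]; apply/andP].
Qed.

(** The two counts differ by the misplaced balls among the first k. *)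
Lemma late_misplaced_bounds (t : T) :
  (late_misplaced k (history t) n <= misplaced X t <=
   late_misplaced k (history t) n + k)%N.
Proof.
rewrite /misplaced (bigID (fun i : 'I_n => (k <= i)%N))/=.
have -> : (\sum_(i < n | (k <= i)%N) (X i t != i) = late_misplaced k (history t) n)%N.
  by apply: eq_big => [i|i _]; rewrite ?ltn_ord ?andbT// ffunE.
rewrite leq_addr leq_add2l.
apply: (@leq_trans (\sum_(i < n | ~~ (k <= i)) 1)%N).
  by apply: leq_sum => i _; exact: leq_b1.
under eq_bigl do rewrite -ltnNge.
by rewrite (big_ord_narrow (ltnW kn)) sum1_card card_ord.
Qed.

Lemma measurable_misplaced_le (x : R) : measurable [set t | (misplaced X t)%:R <= x].
Proof.
have -> : [set t | (misplaced X t)%:R <= x] =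
    [set t | (\sum_(i < n) (history t i != i))%N%:R <= x].
  apply/funext => t /=; rewrite (_ : misplaced X t = \sum_(i < n) (history t i != i))%N//.
  by apply: eq_bigr => i _; rewrite ffunE.
exact: (measurable_history [pred s : hist | (\sum_(i < n) (s i != i))%N%:R <= x]).
Qed.

Lemma prob_misplaced_bounds (x : R) :
  ((bernoulli_sum_cdf (misplacement_odds n k) (n - k) (x - k%:R)%R)%:E <=
   P [set t | ((misplaced X t)%:R <= x)%R] <=
   (bernoulli_sum_cdf (misplacement_odds n k) (n - k) x)%:E)%E.
Proof.
rewrite -!prob_late_misplaced.
have mL y : measurable [set t | (late_misplaced k (history t) n)%:R <= y :> R].
  exact: (measurable_history [pred s : hist | (late_misplaced k s n)%:R <= y]).
have mM := measurable_misplaced_le x.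
apply/andP; split; apply: le_measure; rewrite ?inE// => t /=;
  have /andP[l1 l2] := late_misplaced_bounds t => h.
  apply: le_trans (_ : (late_misplaced k (history t) n + k)%:R <= _).
    by rewrite ler_nat.
  by rewrite natrD -lerBrDr.
by apply: le_trans h; rewrite ler_nat.
Qed.
End placement_law.

(** * Asymptotics of the mean and the variance *)

Section harmonic.
Context {R : realType} (k : nat).
Hypothesis k_gt0 : (0 < k)%N.

Lemma sum_from_end_succ (f : nat -> R) (n : nat) : (k <= n)%N ->
  \sum_(a < n.+1 - k) f (n.+1 - a)%N = f n.+1 + \sum_(a < n - k) f (n - a)%N.
Proof. by move=> kn; rewrite subSn// big_ord_recl. Qed.

Lemma ln_succ_le (n : nat) : (0 < n)%N ->
  ln n.+1%:R - ln n%:R <= n%:R^-1 :> R.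
Proof.
move=> n0; have n0' : 0 < n%:R :> R by rewrite ltr0n.
rewrite -ln_div ?posrE// -natr1 mulrDl divff ?gt_eqF// mul1r.
by apply: le_ln1Dx; apply: lt_trans (_ : 0 < _); rewrite ?invr_gt0// ltrN10.
Qed.

Lemma ln_succ_ge (n : nat) : (0 < n)%N ->
  n.+1%:R^-1 <= ln n.+1%:R - ln n%:R :> R.
Proof.
move=> n0; have n0' : 0 < n%:R :> R by rewrite ltr0n.
have n1 : 0 < n.+1%:R :> R by rewrite ltr0n.
rewrite -[leRHS]opprB lerNr -ln_div ?posrE//.
have -> : n%:R / n.+1%:R = 1 + - n.+1%:R^-1 :> R.
  by rewrite -[X in X / _](addrK 1) natr1 mulrBl divff ?gt_eqF// mul1r.
by apply: le_ln1Dx; rewrite ltrN2 invf_lt1// ltr1n.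
Qed.

(** The sum is that of 1 / j for k < j <= n, and 1 / (n + 1) <= ln (n + 1) - ln n <= 1 / n. *)
Lemma harmonic_ln (n : nat) : (k <= n)%N ->
  ln n%:R - ln k.+1%:R <= (\sum_(a < n - k) (n - a)%:R^-1 : R) <= (ln n%:R : R).
Proof.
move=> kn.
suff : ln n.+1%:R - ln k.+1%:R <= (\sum_(a < n - k) (n - a)%:R^-1 : R) <=
    (ln n%:R - ln k%:R : R).
  move=> /andP[h1 h2]; apply/andP; split.
    apply: le_trans h1; rewrite lerB// ler_ln ?posrE ?ltr0n ?ler_nat//.
    exact: leq_trans kn.
  by apply: le_trans h2 _; rewrite gerBl ln_ge0// ler1n.
elim: n kn => [|n IH] kn; first by have := leq_trans k_gt0 kn.
move: kn; rewrite leq_eqVlt => /predU1P[<-|]; first by rewrite subnn big_ord0 !subrr lexx.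
rewrite ltnS => kn; rewrite (sum_from_end_succ (fun j => j%:R^-1))//.
have n0 : (0 < n)%N := leq_trans k_gt0 kn.
have /andP[h1 h2] := IH kn.
have := ln_succ_le (ltn0Sn n); have := ln_succ_ge n0.
move: h1 h2; set a := ln _.+2%:R; set b := ln n.+1%:R; set c := ln n%:R.
set e := ln k%:R; set f := ln k.+1%:R; set g := _^-1; set h := \sum_(_ < _) _.
by clearbody a b c e f g h => *; apply/andP; split; lra.
Qed.

(** Comparison with the telescoping sum of 1 / (j (j - 1)) = 1 / (j - 1) - 1 / j. *)
Lemma sum_inv_sqr_le1 (n : nat) : (k <= n)%N ->
  0 <= (\sum_(a < n - k) (n - a)%:R^-1 ^+ 2 : R) <= (1 : R).
Proof.
move=> kn; rewrite sumr_ge0 ?exprn_ge0//=.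
have k1 : k%:R^-1 <= 1 :> R by rewrite invf_le1 ?ltr0n// ler1n.
suff : \sum_(a < n - k) (n - a)%:R^-1 ^+ 2 <= k%:R^-1 - n%:R^-1 :> R.
  by move=> h; apply: (le_trans h); apply: le_trans k1; rewrite gerBl.
elim: n kn => [|n IH] kn; first by have := leq_trans k_gt0 kn.
move: kn; rewrite leq_eqVlt => /predU1P[<-|]; first by rewrite subnn big_ord0 !subrr lexx.
rewrite ltnS => kn; rewrite (sum_from_end_succ (fun j => j%:R^-1 ^+ 2))//.
have n0 : (0 < n)%N := leq_trans k_gt0 kn.
have n0' : 0 < n%:R :> R by rewrite ltr0n.
suff step : n.+1%:R^-1 ^+ 2 <= n%:R^-1 - n.+1%:R^-1 :> R.
  by apply: le_trans (lerD step (IH kn)) _; rewrite addrC addrA subrK.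
rewrite -natr1; have -> : n%:R^-1 - (n%:R + 1)^-1 = n%:R^-1 * (n%:R + 1)^-1 :> R.
  by field; rewrite !gt_eqF//; lra.
by rewrite expr2 ler_pM2r ?invr_gt0 ?lef_pV2 ?posrE; lra.
Qed.

Lemma mean_misplacement (n : nat) : (k <= n)%N ->
  `|\sum_(a < n - k) misplacement_odds n k a - k%:R * ln n%:R| <=
  k%:R * ln k.+1%:R :> R.
Proof.
move=> kn; rewrite -mulr_sumr -mulrBr normrM normr_nat ler_wpM2l//.
have /andP[h1 h2] := harmonic_ln kn.
have : 0 <= ln k.+1%:R :> R by rewrite ln_ge0// ler1n.
move: h1 h2; set a := ln n%:R; set b := ln k.+1%:R; set s := \sum_(_ < _) _.
by clearbody a b s => *; rewrite ler_norml; apply/andP; split; lra.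
Qed.

Lemma variance_misplacement (n : nat) : (k <= n)%N ->
  `|\sum_(a < n - k) misplacement_odds n k a * (1 - misplacement_odds n k a) -
    k%:R * ln n%:R| <= k%:R * ln k.+1%:R + k%:R ^+ 2 :> R.
Proof.
move=> kn; have := mean_misplacement kn.
have /andP[h1 h2] := sum_inv_sqr_le1 kn.
have -> : \sum_(a < n - k) misplacement_odds n k a * (1 - misplacement_odds n k a) =
  \sum_(a < n - k) misplacement_odds n k a -
  k%:R ^+ 2 * \sum_(a < n - k) (n - a)%:R^-1 ^+ 2 :> R.
  rewrite mulr_sumr -sumrB; apply: eq_bigr => a _.
  by rewrite /misplacement_odds; ring.
have : 0 <= k%:R ^+ 2 :> R by rewrite exprn_ge0.
move: h1 h2; set a := _ * ln n%:R; set b := _ * ln k.+1%:R.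
set s := \sum_(_ < _) _; set r := \sum_(_ < _) _; set c := _ ^+ 2.
clearbody a b c s r => s0 s1 c0; rewrite !ler_norml => /andP[? ?].
by apply/andP; split; nra.
Qed.
End harmonic.

(** * Passage to the limit *)

Section limit.
Context {R : realType}.
Implicit Types (u w a : nat -> R).

Lemma cvg_bounded_mul0 a w (c : R) : (\forall n \near \oo, `|a n| <= c) ->
  w n @[n --> \oo] --> 0 -> a n * w n @[n --> \oo] --> 0.
Proof.
move=> ac w0; apply/(@norm_cvg0P _ R).
have cw : c * `|w n| @[n --> \oo] --> 0.
  by rewrite -(mulr0 c); apply: cvgMl_tmp; rewrite -(normr0 R); exact: cvg_norm.
apply: (@squeeze_cvgr _ _ _ _ (cst 0) _ _ _ _ (cvg_cst _) cw).
near=> n; rewrite normr_ge0/= normrM ler_wpM2r//.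
by near: n.
Unshelve. all: by end_near. Qed.

(** The argument of Phi tends to x: with u^16 for the variance scale and m, v within
O(1) of it, both the smoothing variance u^12 and the shift e u^7 are of smaller
order than u^16 and its square root u^8. *)
Lemma cvg_Phi_normalized u (m v : nat -> R) (x e c : R) :
  u n @[n --> \oo] --> +oo ->
  (\forall n \near \oo, `|m n - u n ^+ 16| <= c) ->
  (\forall n \near \oo, `|v n - u n ^+ 16| <= c) ->
  Phi ((u n ^+ 16 + x * u n ^+ 8 - m n + e * u n ^+ 7) /
    Num.sqrt ((u n ^+ 6) ^+ 2 + v n)) @[n --> \oo] --> Phi x.
Proof.
move=> uoo mc vc.
have u0 : \forall n \near \oo, 0 < u n by move/cvgryPgt : uoo; apply.
pose w n := (u n)^-1.
have w0 : w n @[n --> \oo] --> 0 by apply/(gtr0_cvgV0 u0).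
have wX i : w n ^+ i.+1 @[n --> \oo] --> 0.
  elim: i => [|i IH]; first exact: w0.
  under eq_fun do rewrite exprS; rewrite -(mulr0 0); exact: cvgM.
have Phi_cont : {for x, continuous (@Phi R)}.
  have dPhi := is_derive_Phi x.
  exact/differentiable_continuous/derivable1_diffP.
apply: continuous_cvg; first exact: Phi_cont.
pose f n := (x + (- (m n - u n ^+ 16)) * w n ^+ 8 + e * w n) /
  Num.sqrt (1 + w n ^+ 4 + (v n - u n ^+ 16) * w n ^+ 16).
have fx : f n @[n --> \oo] --> x.
  rewrite -[X in _ --> X]divr1 -{1}sqrtr1; apply: cvgM; last first.
    apply: cvgV; first by rewrite sqrtr1 oner_neq0.
    apply: continuous_cvg; first exact: sqrt_continuous.
    rewrite -{2}(addr0 1) -{2}(addr0 1); apply: cvgD; last exact: cvg_bounded_mul0 vc (wX _).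
    by apply: cvgD; [exact: cvg_cst|exact: wX].
  rewrite -{2}(addr0 x) -{2}(addr0 x); apply: cvgD; last first.
    by rewrite -(mulr0 e); exact: cvgMl_tmp.
  apply: cvgD; first exact: cvg_cst.
  by apply: cvg_bounded_mul0 (wX _); apply: filterS mc => n; rewrite normrN; apply.
apply: cvg_trans fx; apply: near_eq_cvg; near=> n.
have un : 0 < u n by near: n.
have ? : u n != 0 by rewrite gt_eqF.
rewrite /f /w.
have -> : (u n ^+ 6) ^+ 2 + v n = (u n ^+ 8) ^+ 2 *
   (1 + (u n)^-1 ^+ 4 + (v n - u n ^+ 16) * (u n)^-1 ^+ 16) by field.
rewrite sqrtrM ?sqr_ge0// sqrtr_sqr gtr0_norm ?exprn_gt0// invfM [RHS]mulrA.
congr (_ / _).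
by field.
Unshelve. all: by end_near. Qed.

End limit.

Theorem mainTheorem2 (R : realType) (k : nat) (hk : (1 <= k)%N)
    (d : nat -> measure_display) (T : forall n : nat, measurableType (d n))
    (P : forall n : nat, probability (T n) R)
    (X : forall n : nat, 'I_n -> T n -> 'I_n)
    (hX : forall n : nat, (k.+1 <= n)%N ->
       placement_procedure (P n) k (X n)) :
  cvg_in_distribution P
    (fun n t => ((misplaced (X n) t)%:R - k%:R * ln n%:R)
                / Num.sqrt (k%:R * ln n%:R))
    (normal_prob 0 1).
Proof.
split.
  exists k.+1 => // n /= kn _ Y _; rewrite setTI.
  pose g (s : {ffun 'I_n -> 'I_n}) : R :=
    ((\sum_(i < n) (s i != i))%N%:R - k%:R * ln n%:R) / Num.sqrt (k%:R * ln n%:R).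
  have := measurable_history (hX n kn) [pred s | `[< Y (g s) >]].
  congr (measurable _); apply/funext => t /=.
  rewrite asboolE; congr (Y ((_%:R - _) / _)).
  by apply: eq_bigr => i _; rewrite ffunE.
move=> x _; rewrite [X in _ --> X]PhiE.
pose L (n : nat) : R := k%:R * ln n%:R.
have k0 : 0 < k%:R :> R by rewrite ltr0n.
have Ln (n : nat) : (k < n)%N -> 0 < L n.
  by move=> kn; rewrite mulr_gt0// ln_gt0// ltr1n (leq_trans _ kn).
(* The sixteenth root makes s, b and sqrt (k ln n) powers of u. *)
pose u (n : nat) : R := L n `^ 16%:R^-1.
have uX (n : nat) : (k < n)%N -> u n ^+ 16 = L n.
  move=> kn; rewrite -powR_mulrn ?powR_ge0// -powRrM mulVf// powRr1//.
  exact/ltW/Ln.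
have uoo : u n @[n --> \oo] --> +oo.
  apply/cvgryPge => A; pose B := Num.max A 1.
  have B0 : 0 < B by rewrite lt_max ltr01 orbT.
  exists (maxn k.+1 (Num.truncn (expR (B ^+ 16))).+1) => // n /=.
  rewrite geq_max => /andP[kn Bn].
  apply: le_trans (_ : B <= _); first by rewrite le_max lexx.
  rewrite -(@ler_pXn2r _ 16)// ?nnegrE ?powR_ge0 ?(ltW B0)//.
  rewrite uX//; apply: le_trans (_ : ln n%:R <= _); last first.
    by rewrite ler_peMl ?ler1n// ln_ge0// ler1n (leq_trans _ kn).
  rewrite -(expRK (B ^+ 16)) ler_ln ?posrE ?expR_gt0//; last by rewrite ltr0n (leq_trans _ kn).
  by rewrite (le_trans (ltW (truncnS_gt _)))// ler_nat.
pose c : R := k%:R * ln k.+1%:R + k%:R ^+ 2 + k%:R.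
pose m (n : nat) : R := \sum_(a < n - k) misplacement_odds n k a.
pose v (n : nat) : R :=
  \sum_(a < n - k) misplacement_odds n k a * (1 - misplacement_odds n k a).
have c1 : 0 <= k%:R * ln k.+1%:R :> R by rewrite mulr_ge0// ln_ge0// ler1n.
have c2 : 0 <= k%:R ^+ 2 :> R by rewrite exprn_ge0.
have mc : \forall n \near \oo, `|m n - u n ^+ 16| <= c.
  exists k.+1 => // n /= kn; rewrite uX//.
  by apply: le_trans (mean_misplacement hk (ltnW kn)) _; rewrite /c; lra.
have mc' : \forall n \near \oo, `|(m n + k%:R) - u n ^+ 16| <= c.
  exists k.+1 => // n /= kn; rewrite uX// addrAC.
  apply: le_trans (ler_normD _ _) _; rewrite normr_nat /c lerD2r.
  by apply: le_trans (mean_misplacement hk (ltnW kn)) _; lra.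
have vc : \forall n \near \oo, `|v n - u n ^+ 16| <= c.
  exists k.+1 => // n /= kn; rewrite uX//.
  by apply: le_trans (variance_misplacement hk (ltnW kn)) _; rewrite /c; lra.
have vcvg : v n / u n ^+ 18 @[n --> \oo] --> 0.
  have v1 : \forall n \near \oo, `|v n / u n ^+ 16| <= 1 + c.
    near=> n; have u1 : 1 <= u n by near: n; move/cvgryPge : uoo; apply.
    have uk : 0 < u n ^+ 16 by rewrite exprn_gt0//; lra.
    rewrite normrM normfV (gtr0_norm uk) ler_pdivrMr// mulrDl mul1r.
    have : `|v n - u n ^+ 16| <= c by near: n.
    have : c <= c * u n ^+ 16.
      by rewrite ler_peMr// ?exprn_ege1//; rewrite /c; lra.
    move=> c3 c4; rewrite -[v n](subrK (u n ^+ 16)); apply: le_trans (ler_normD _ _) _.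
    by rewrite (gtr0_norm uk) addrC lerD2l (le_trans c4).
  have w2 : (u n)^-1 ^+ 2 @[n --> \oo] --> 0.
    have w0 : (u n)^-1 @[n --> \oo] --> 0.
      by apply/gtr0_cvgV0 => //; move/cvgryPgt : uoo; apply.
    by under eq_fun do rewrite expr2; rewrite -(mulr0 0); exact: cvgM.
  apply: cvg_trans (cvg_bounded_mul0 v1 w2); apply: near_eq_cvg; near=> n.
  have u1 : 1 <= u n by near: n; move/cvgryPge : uoo; apply.
  by field; lra.
have err0 : 64 * (v n / u n ^+ 18) @[n --> \oo] --> 0.
  by rewrite -(mulr0 64); exact: cvgMl_tmp.
(* The bounds of bernoulli_sum_cdf_normal for s = u^6 and b = u^7; the k in lower
   accounts for the absent-minded balls. *)
pose lower (n : nat) := Phi ((u n ^+ 16 + x * u n ^+ 8 - (m n + k%:R) + -1 * u n ^+ 7) /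
    Num.sqrt ((u n ^+ 6) ^+ 2 + v n)) - (Phi (- u n) + 64 * (v n / u n ^+ 18)).
pose upper (n : nat) := Phi ((u n ^+ 16 + x * u n ^+ 8 - m n + 1 * u n ^+ 7) /
    Num.sqrt ((u n ^+ 6) ^+ 2 + v n)) + (1 - Phi (u n) + 64 * (v n / u n ^+ 18)).
have lower_cvg : (lower n)%:E @[n --> \oo] --> (Phi x)%:E.
  apply: cvg_EFin; first exact: nearW.
  suff : lower n @[n --> \oo] --> Phi x - (0 + 0) by rewrite addr0 subr0.
  apply: cvgB; first exact: cvg_Phi_normalized uoo mc' vc.
  apply: cvgD err0; apply: cvg_comp cvg_Phi_ninfty.
  exact/cvgNrNy.
have upper_cvg : (upper n)%:E @[n --> \oo] --> (Phi x)%:E.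
  apply: cvg_EFin; first exact: nearW.
  suff : upper n @[n --> \oo] --> Phi x + (1 - 1 + 0).
    by rewrite subrr !addr0.
  apply: cvgD; first exact: cvg_Phi_normalized uoo mc vc.
  apply: cvgD err0; apply: cvgB; first exact: cvg_cst.
  exact: cvg_comp cvg_Phi_pinfty.
apply: (squeeze_cvge _ lower_cvg upper_cvg).
near=> n.
have kn : (k < n)%N by near: n; exists k.+1.
have u1 : 1 <= u n by near: n; move/cvgryPge : uoo; apply.
have u0 : 0 < u n by lra.
have sqrtL : Num.sqrt (L n) = u n ^+ 8.
  by rewrite -uX// (_ : 16 = 8 * 2)%N// exprM sqrtr_sqr ger0_norm// exprn_ge0// ltW.
have -> : (fun t => ((misplaced (X n) t)%:R - k%:R * ln n%:R) /
      Num.sqrt (k%:R * ln n%:R)) @^-1` `]-oo, x] =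
    [set t | (misplaced (X n) t)%:R <= u n ^+ 16 + x * u n ^+ 8].
  apply/funext => t; rewrite /= in_itv/= -/(L n) sqrtL uX//.
  by rewrite ler_pdivrMr ?exprn_gt0// lerBlDl.
have := prob_misplaced_bounds kn (hX n kn) (u n ^+ 16 + x * u n ^+ 8).
have p01 i : (i < n - k)%N -> 0 <= (misplacement_odds n k i : R) <= 1.
  move=> ink; rewrite /misplacement_odds divr_ge0//=.
  have kni : (k <= n - i)%N by rewrite ltnW// ltn_subRL addnC -ltn_subRL.
  by rewrite ler_pdivrMr ?mul1r ?ler_nat// ltr0n (leq_trans hk).
have s1 : 1 <= u n ^+ 6 by rewrite exprn_ege1.
have b0 : 0 <= u n ^+ 7 by rewrite exprn_ge0// ltW.
have bs : u n ^+ 7 / u n ^+ 6 = u n by field; lra.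
have bs' : - u n ^+ 7 / u n ^+ 6 = - u n by field; lra.
have := bernoulli_sum_cdf_normal p01 s1 b0.
rewrite -/(m n) -/(v n) bs bs' -exprM => bound /andP[h1 h2].
apply/andP; split.
  apply: le_trans h1; rewrite lee_fin.
  have /andP[+ _] := bound (u n ^+ 16 + x * u n ^+ 8 - k%:R).
  apply: le_trans; rewrite /lower mulN1r exprM -mulrA.
  by rewrite -(exprM (u n) 6 3) opprD addrA (addrAC _ (- m n)).
apply: le_trans h2 _; rewrite lee_fin.
have /andP[_] := bound (u n ^+ 16 + x * u n ^+ 8).
by rewrite /upper mul1r exprM -mulrA -(exprM (u n) 6 3).
Unshelve. all: by end_near. Qed.
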